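(* Let $\Delta$ and $\Upsilon$ be combinatorially equivalent simplicial complexes of dimension $d\ge1$. Then $\Phi_\Delta(q)=\Phi_\Upsilon(q)$ for every positive integer $q$.
   Context: All simplicial complexes are finite. For a simplicial complex $\Delta$ of dimension $d$, let $F$ be its set of $d$-simplices (facets) and $R$ its set of $(d-1)$-simplices (ridges); fix an orientation of each simplex and let $\partial\in\mathbb{Z}^{R\times F}$ be the simplicial boundary matrix. A $q$-flow is a vector $\varphi\in\{0,\dots,q-1\}^{F}$ with $\partial\varphi\equiv0\pmod q$; it is nowhere-zero if all entries are nonzero; $\Phi_\Delta(q)$ is the number of nowhere-zero $q$-flows. A subdivision of a facet $\sigma$ of $\Delta$ replaces $\sigma$ by the simplices $(\sigma\setminus\{i\})\cup\{v\}$, $i\in\sigma$, together with all their faces, where $v$ is a new vertex. A refinement of $\Delta$ is a complex obtained from $\Delta$ by a finite sequence of such subdivisions. Two complexes are combinatorially equivalent if they have refinements which are the same simplicial complex (up to isomorphism). *)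

(* Defs.v *)
From mathcomp Require Import all_boot all_order all_algebra.

Set Implicit Arguments.
Unset Strict Implicit.
Unset Printing Implicit Defensive.

Import GRing.Theory.
Local Open Scope ring_scope.

(* A finite simplicial complex is a family of subsets of a finite ground type;
   an element of the ground type is a vertex only if its singleton is a face.
   The empty set counts as a face, of dimension -1. *)
Definition simplicial_complex (T : finType) (D : {set {set T}}) : Prop :=
  set0 \in D /\
  (forall s t : {set T}, s \in D -> t \subset s -> t \in D).

Definition vertices (T : finType) (D : {set {set T}}) : {set T} :=
  [set x | [set x] \in D].

Definition simplices (T : finType) (D : {set {set T}}) (k : nat) :
    {set {set T}} :=
  [set s in D | #|s| == k.+1].

(* Because of the truncated predecessor the complex [set set0] also gets
   dimension 0; the value is the usual one as soon as it is positive. *)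
Definition complex_dim (T : finType) (D : {set {set T}}) : nat :=
  (\max_(s in D) #|s|).-1.

Definition facets (T : finType) (D : {set {set T}}) : {set {set T}} :=
  simplices D (complex_dim D).

(* Only meaningful in positive dimension. *)
Definition ridges (T : finType) (D : {set {set T}}) : {set {set T}} :=
  simplices D (complex_dim D).-1.

(* An orientation of a simplex is represented by an ordering of its vertices;
   two orderings represent the same orientation when they differ by an even
   permutation, i.e. when [sign_between] is 1. *)
Definition orients (T : finType) (o : {set T} -> seq T) (D : {set {set T}}) :
    Prop :=
  forall s : {set T}, s \in D -> perm_eq (o s) (enum s).

(* Sign of the permutation taking the ordering s to the ordering t of the same
   vertices, as (-1) to the number of inversions. *)
Definition sign_between (T : finType) (s t : seq T) : int :=
  (-1) ^+ #|[set p : T * T | (index p.1 s < index p.2 s < size s)%N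
                             && (index p.2 t < index p.1 t)%N]|.

(* Coefficient of r in the boundary of s, where
   boundary [v_0, ..., v_d]
     = \sum_k (-1)^k [v_0, ..., v_(k-1), v_(k+1), ..., v_d]. *)
Definition incidence (T : finType) (o : {set T} -> seq T) (r s : {set T}) :
    int :=
  \sum_(i in s | s :\ i == r)
    (-1) ^+ index i (o s) * sign_between (rem i (o s)) (o r).

Definition boundary (T : finType) (D : {set {set T}}) (o : {set T} -> seq T) :
    'M[int]_(#|ridges D|, #|facets D|) :=
  \matrix_(i, j) incidence o (enum_val i) (enum_val j).

Definition is_flow (T : finType) (D : {set {set T}}) (o : {set T} -> seq T)
    (q : nat) (phi : 'cV['I_q]_#|facets D|) : bool :=
  [forall i : 'I_#|ridges D|,
    ((boundary D o *m map_mx (fun x : 'I_q => (nat_of_ord x)%:Z) phi) i ord0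
       == 0 %[mod q%:Z])%Z].

Definition nowhere_zero (n q : nat) (phi : 'cV['I_q]_n) : bool :=
  [forall j : 'I_n, nat_of_ord (phi j ord0) != 0%N].

Definition nb_nowhere_zero_flows (T : finType) (D : {set {set T}})
    (o : {set T} -> seq T) (q : nat) : nat :=
  #|[set phi : 'cV['I_q]_#|facets D| | is_flow o phi & nowhere_zero phi]|.

(* The new vertex is None; the old vertex x becomes Some x. *)
Definition subdivision (T : finType) (D : {set {set T}}) (s : {set T}) :
    {set {set option T}} :=
  [set [set Some x | x in t] | t : {set T} in D :\ s] :|:
  [set t : {set option T} |
    [exists i in s, t \subset None |: [set Some x | x in s :\ i]]].

Inductive refinement (T : finType) (D : {set {set T}}) :
    forall U : finType, {set {set U}} -> Prop :=
| refinement_refl : refinement D D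
| refinement_subdivision (U : finType) (E : {set {set U}}) (s : {set U}) :
    refinement D E -> s \in facets E -> refinement D (subdivision E s).

Definition isomorphic (T U : finType) (D : {set {set T}}) (E : {set {set U}}) :
    Prop :=
  exists f : T -> U,
    {in vertices D &, injective f} /\
    [set f @: s | s : {set T} in D] = E.

Definition combinatorially_equivalent (T U : finType)
    (D : {set {set T}}) (Y : {set {set U}}) : Prop :=
  exists (T' U' : finType) (D' : {set {set T'}}) (Y' : {set {set U'}}),
    [/\ refinement D D', refinement Y Y' & isomorphic D' Y'].

(* Main.v *)
Require Import Defs.
From mathcomp Require Import all_boot all_order all_algebra.
From mathcomp Require Import zify.

(* Flows with values in a finite abelian group G are considered, q-flows being
   the case G = Z/q. Reversing the orientation of a simplex only changes signs,
   so the number of nowhere-zero flows does not depend on the orientation, and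
   it suffices to treat isomorphisms and a single subdivision of a facet s with
   apex v. On the ridge {v} + s \ {i, j} the flow equation involves only the
   two facets opposite to i and j, and, once v is put in the place of the vertex
   it replaces, it says that their values agree. Hence a flow on the subdivision
   is constant on the new facets, and the remaining equations are those of the
   original complex with this constant as the value on s. *)

Set Implicit Arguments.
Unset Strict Implicit.
Unset Printing Implicit Defensive.

Import GRing.Theory.
Local Open Scope ring_scope.

(** * Signs of orderings *)

(** [index] returns [size s] on elements outside [s], so the bound by [size s] confines the relation
    to the elements of [s]. *)
Definition before (T : eqType) (s : seq T) : rel T :=
  fun x y => (index x s < index y s < size s)%N.

Section Before.
Variable T : eqType.
Implicit Types (s t : seq T) (x y i : T).

Lemma before_mem s x y : before s x y -> (x \in s) && (y \in s).
Proof. by rewrite /before -!index_mem => /andP[h1 h2]; rewrite h2 (ltn_trans h1 h2). Qed.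

Lemma before_asym s x y : before s x y -> ~~ before s y x.
Proof. by rewrite /before; lia. Qed.

Lemma before_total s x y :
  before s x y || before s y x = [&& x != y, x \in s & y \in s].
Proof.
rewrite -!index_mem /before; case: eqVneq => [->|nxy] /=; first by lia.
case: (ltngtP (index x s) (index y s)) => h; rewrite ?andbT ?orbF //=; try lia.
case: (ltnP (index x s) (size s)) => //= hx; symmetry.
move: nxy; rewrite -(nth_index x (s := s) (x := y)); last by rewrite -index_mem -h.
by rewrite -h nth_index ?eqxx // -index_mem.
Qed.

Lemma before_rem s i x y : uniq s -> i \in s -> x != i -> y != i ->
  before (rem i s) x y = before s x y.
Proof.
move=> us; move: us => /[swap] /splitPr[s1 s2] us xi yi.
have i1 : i \notin s1.
  by move: us; rewrite cat_uniq /= => /and3P[_]; rewrite negb_or => /andP[].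
have -> : rem i (s1 ++ i :: s2) = s1 ++ s2.
  clear us; elim: s1 i1 => [|z s1' IH] /=; first by rewrite eqxx.
  by rewrite inE negb_or eq_sym => /andP[/negPf-> /IH->].
rewrite /before !index_cat !size_cat /= -!index_mem.
rewrite -[i == x]eq_sym -[i == y]eq_sym (negPf xi) (negPf yi).
by case: ifP => hx; case: ifP => hy; lia.
Qed.

End Before.

Section Signs.
Variable T : finType.
Implicit Types (s t : seq T) (x y i j : T).

(** For symmetric [g] this is a product over unordered pairs of distinct elements, and each such
    pair occurs exactly once in either ordering. The pairs on which [s] and [t] disagree are matched
    by exchanging components. *)
Lemma prod_orderings (s t : seq T) (g : T -> T -> int) :
  s =i t -> (forall x y, before s x y -> g x y = g y x) ->
  \prod_(p : T * T | before s p.1 p.2) g p.1 p.2 =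
  \prod_(p : T * T | before t p.1 p.2) g p.1 p.2.
Proof.
move=> st gC; have tot x y : before s x y || before s y x = before t x y || before t y x.
  by rewrite !before_total !st.
rewrite (bigID (fun p => before t p.1 p.2)) [RHS](bigID (fun p => before s p.1 p.2)) /=.
congr (_ * _); first by apply: eq_bigl => p; rewrite andbC.
have sw : injective (fun p : T * T => (p.2, p.1)) by move=> [? ?] [? ?] [-> ->].
rewrite [RHS](reindex_inj sw) /=.
apply: eq_big => [[x y] /=|[x y] /= /andP[/gC]//].
have := tot x y; have := @before_asym _ s x y; have := @before_asym _ t x y.
by case: (before s x y); case: (before t x y); case: (before s y x); case: (before t y x) => //=
  a b;
   (try by have := a isT); (try by have := b isT).
Qed.

Lemma sign_betweenE s t : s =i t ->
  sign_between s t = \prod_(p : T * T | before s p.1 p.2) (-1) ^+ before t p.2 p.1.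
Proof.
move=> st; rewrite /sign_between -prodr_const big_mkcond [RHS]big_mkcond /=.
apply: eq_bigr => -[x y] _; rewrite inE /=; case: ifP => [/andP[a b]|].
  rewrite -[_ && _]/(before s x y) in a; rewrite a /before b /=.
  by case/andP: (before_mem a); rewrite !st -index_mem => ->.
rewrite -[(_ < _ < size s)%N]/(before s x y); case: ifP => // a /=.
by rewrite /before => ->.
Qed.

(** On each pair, the disagreement of [s] with [u] is the exclusive or of the disagreements of [s]
    with [t] and of [t] with [u]. *)
Lemma sign_between_mul s t u : s =i t -> t =i u ->
  sign_between s t * sign_between t u = sign_between s u.
Proof.
move=> st tu; have su : s =i u by move=> x; rewrite st.
have flip a b : a =i b -> sign_between a b =
    \prod_(p : T * T | before a p.1 p.2) (-1) ^+ (before a p.1 p.2 (+) before b p.1 p.2).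
  move=> ab; rewrite sign_betweenE //; apply: eq_bigr => -[x y] /= xy; congr (_ ^+ _).
  have: before a x y || before a y x = before b x y || before b y x.
    by rewrite !before_total !ab.
  rewrite xy /=; have := @before_asym _ b x y.
  by case: (before b x y); case: (before b y x) => //= /(_ isT).
(* Whether [t] and [u] disagree on a pair does not depend on the order of its components, so this
   product may be taken over the pairs of [s]. *)
rewrite !flip // -(@prod_orderings s t
    (fun x y => (-1) ^+ (before t x y (+) before u x y))) // => [|x y xy].
  rewrite -big_split /=; apply: eq_bigr => -[x y] /= _; rewrite -signr_addb.
  by congr (_ ^+ _); case: (before s x y); case: (before t x y); case: (before u x y).
congr (_ ^+ _); have: [&& x != y, x \in s & y \in s] by rewrite -before_total xy.
move=> h; have ht : before t x y || before t y x by rewrite before_total -!st.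
have hu : before u x y || before u y x by rewrite before_total -!tu -!st.
have := @before_asym _ t x y; have := @before_asym _ u x y; move: ht hu.
by case: (before t x y); case: (before t y x); case: (before u x y); case: (before u y x) => //=
  _ _ a b;
   (try by have := a isT); (try by have := b isT).
Qed.

Lemma sign_between_refl s : sign_between s s = 1.
Proof.
rewrite sign_betweenE //; apply: big1 => -[x y] /= /before_asym.
by case: (before s y x).
Qed.

Lemma sign_between_sqr s t : sign_between s t * sign_between s t = 1.
Proof. by rewrite -expr2 sqrr_sign. Qed.

Lemma card_before s i : uniq s -> i \in s ->
  #|[set x | before s x i]| = index i s.
Proof.
move=> us si; rewrite -[RHS](@size_takel _ _ s); last by rewrite ltnW // index_mem.
rewrite -(card_uniqP _) ?take_uniq //; apply: eq_card => x.
rewrite inE /before index_mem si andbT.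
case: (boolP (x \in s)) => xs; first by rewrite in_take.
by rewrite (memNindex xs) ltnNge index_size /=; apply/esym/negP => /mem_take; apply/negP.
Qed.

(** Moving [i] to the front passes the [index i s] elements before it; all other inversions avoid
    [i]. The right-hand side is the coefficient in the boundary formula. *)
Lemma sign_between_cons s t i : uniq s -> perm_eq s (i :: t) ->
  sign_between s (i :: t) = (-1) ^+ index i s * sign_between (rem i s) t.
Proof.
move=> us st; have si : i \in s by rewrite (perm_mem st) mem_head.
have ut : uniq (i :: t) by rewrite -(perm_uniq st).
have st' : rem i s =i t.
  by apply: perm_mem; rewrite -(perm_cons i) -(permPl (perm_to_rem si)).
rewrite !sign_betweenE //; last exact: perm_mem.
rewrite -(card_before us si) -prodr_const.
rewrite (bigID (fun p => p.2 == i)) /=; congr (_ * _).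
  rewrite (reindex_onto (fun x => (x, i)) (fun p => p.1)) /= => [|[x y] /= /andP[_ /eqP->]//].
  apply: eq_big => [x|x]; first by rewrite inE !eqxx !andbT.
  rewrite !eqxx !andbT => h; rewrite (_ : before _ _ _ = true) ?expr1 //;
    rewrite /before /= eqxx /=.
  have nxi : i == x = false.
    by apply/negP => /eqP e; move: h; rewrite /before e; lia.
  have := before_mem h; rewrite (perm_mem st) nxi => /andP[+ _].
  by rewrite inE eq_sym nxi /= -index_mem ltnS => ->.
rewrite (bigID (fun p => p.1 == i)) /= big1 ?mul1r => [|[x y] /= /andP[/andP[h yi] /eqP e]].
  apply: eq_big => [[x y] /=|[x y] /= /andP[/andP[_ yi] xi]].
    case: (eqVneq y i) => [->|yi]; last case: (eqVneq x i) => [->|xi];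
      rewrite /= ?andbF ?andbT //.
    - apply/esym/negP => /before_mem/andP[_].
      by rewrite mem_rem_uniqF.
    - apply/esym/negP => /before_mem/andP[+ _].
      by rewrite mem_rem_uniqF.
    - by rewrite before_rem.
  by rewrite /before /= ![i == _]eq_sym (negPf yi) (negPf xi) !ltnS.
by rewrite /before e /= eqxx ltn0.
Qed.

(** By multiplicativity only the exchange of the first two entries matters, and there [j] passes one
    element. *)
Lemma sign_between_swap s t i j : uniq s -> perm_eq s (i :: j :: t) ->
  sign_between s (i :: j :: t) = - sign_between s (j :: i :: t).
Proof.
move=> us st; have uij : uniq [:: i, j & t] by rewrite -(perm_uniq st).
have m : [:: i, j & t] =i [:: j, i & t] by move=> x; rewrite !inE orbCA.
rewrite -(sign_between_mul (perm_mem st) m).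
have /andP[/andP[ij _] _] : (i != j) && (i \notin t) && uniq (j :: t).
  by move: uij; rewrite /= inE negb_or.
rewrite (sign_between_cons uij) ?(perm_catCA [:: i] [:: j]) //.
rewrite /= (negPf ij) eqxx sign_between_refl.
by rewrite mulr1 expr1 mulrN1 opprK.
Qed.
End Signs.

(** Injectivity is asked on [s] only, because an isomorphism of complexes is injective merely on the
    vertices. *)
Lemma sign_between_map (T U : finType) (f : T -> U) (s t : seq T) :
  uniq s -> perm_eq s t -> {in s &, injective f} ->
  sign_between (map f s) (map f t) = sign_between s t.
Proof.
elim: t s => [|i t IH] s us st finj.
  by move/perm_nilP: st => ->; rewrite !sign_between_refl.
have si : i \in s by rewrite (perm_mem st) mem_head.
have st' : perm_eq (rem i s) t by rewrite -(perm_cons i) -(permPl (perm_to_rem si)).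
have usf : uniq (map f s) by rewrite map_inj_in_uniq.
have index_f : index (f i) (map f s) = index i s.
  rewrite -{1}(nth_index i si) -(nth_map i (f i)) ?index_mem // index_uniq //.
  by rewrite size_map index_mem.
have rem_f : rem (f i) (map f s) = map f (rem i s).
  rewrite !rem_filter // filter_map; congr map; apply: eq_in_filter => x xs /=.
  by rewrite (inj_in_eq finj).
rewrite /= (sign_between_cons usf (perm_map f st)) (sign_between_cons us st).
rewrite index_f rem_f IH ?rem_uniq // => x y xs ys;
  apply: finj; [exact: mem_rem xs | exact: mem_rem ys].
Qed.

(** * Flows and orientations *)

Section Incidence.
Variables (T : finType) (D : {set {set T}}) (o : {set T} -> seq T).
Hypotheses (cD : simplicial_complex D) (oD : orients o D).

Lemma orients_uniq s : s \in D -> uniq (o s).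
Proof. by move=> /oD /perm_uniq ->; rewrite enum_uniq. Qed.

Lemma orients_mem s : s \in D -> o s =i s.
Proof. by move=> /oD /perm_mem h x; rewrite h mem_enum. Qed.

Lemma perm_orients s t : s \in D -> uniq t -> t =i s -> perm_eq (o s) t.
Proof.
by move=> sD ut ts; apply: uniq_perm (orients_uniq sD) ut _ => x; rewrite orients_mem.
Qed.

Lemma simplexD1 s i : s \in D -> s :\ i \in D.
Proof. by case: cD => _ sub /sub; apply; rewrite subsetDl. Qed.

(** The set [s :\ i] determines [i], so the sum has one term, which [sign_between_cons] rewrites.
    Incidence numbers can then be compared by multiplicativity of signs. *)
Lemma incidence_face s i : s \in D -> i \in s ->
  incidence o (s :\ i) s = sign_between (o s) (i :: o (s :\ i)).
Proof.
move=> sD si; rewrite /incidence (big_pred1 i) => [|j /=].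
  rewrite sign_between_cons ?orients_uniq //; apply: perm_orients => //=.
    rewrite orients_uniq ?simplexD1 // orients_mem ?simplexD1 //.
    by rewrite !inE eqxx.
  by move=> x; rewrite inE orients_mem ?simplexD1 // !inE; case: eqVneq => [->|].
apply/andP/eqP => [[sj /eqP e]|->]; last by [].
by apply/eqP/negPn/negP => ji; have := setD11 j s; rewrite e !inE ji sj.
Qed.

Lemma incidence_nonface (r s : {set T}) : (forall i, i \in s -> s :\ i != r) ->
  incidence o r s = 0.
Proof.
by move=> h; apply: big1 => i /andP[/h /negPf ->].
Qed.

End Incidence.

(* Here k + 1 is the dimension of D; cochains are functions on all sets of
   vertices, so the support condition also makes them vanish off the facets. *)
Definition flows (G : finZmodType) (T : finType) (D : {set {set T}})
    (o : {set T} -> seq T) (k : nat) : {set {ffun {set T} -> G}} :=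
  [set c : {ffun {set T} -> G} | [forall s, (c s != 0) == (s \in simplices D k.+1)] &
    [forall r in simplices D k,
      \sum_(s in simplices D k.+1) c s *~ incidence o r s == 0]].

Lemma flowsP (G : finZmodType) (T : finType) (D : {set {set T}}) o k
    (c : {ffun {set T} -> G}) :
  reflect ((forall s, (c s != 0) = (s \in simplices D k.+1)) /\
           (forall r, r \in simplices D k ->
              \sum_(s in simplices D k.+1) c s *~ incidence o r s = 0))
    (c \in flows G D o k).
Proof.
rewrite inE; apply: (iffP andP) => -[h1 h2]; split.
- by move=> s; have /eqP := forallP h1 s.
- by move=> r rD; apply/eqP; move/forall_inP: h2 => h2; exact: h2.
- by apply/forallP => s; rewrite h1.
- by apply/forall_inP => s sD; apply/eqP/h2.
Qed.

Lemma flow_out (G : finZmodType) (T : finType) (D : {set {set T}}) o k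
    (c : {ffun {set T} -> G}) s :
  c \in flows G D o k -> s \notin simplices D k.+1 -> c s = 0.
Proof. by move=> /flowsP[h _]; rewrite -h negbK => /eqP. Qed.

(** Multiplying the value on each simplex by the sign between its two orderings is injective and
    multiplies the boundary at [r] by the sign of [r]. An inequality suffices, by symmetry. *)
Lemma leq_card_flows_orientation (G : finZmodType) (T : finType)
    (D : {set {set T}}) (o o' : {set T} -> seq T) k :
  simplicial_complex D -> orients o D -> orients o' D ->
  (#|flows G D o k| <= #|flows G D o' k|)%N.
Proof.
move=> cD oD oD'.
have sq s : sign_between (o s) (o' s) * sign_between (o s) (o' s) = 1.
  exact: sign_between_sqr.
pose f (c : {ffun {set T} -> G}) :=
  [ffun s => c s *~ sign_between (o s) (o' s)] : {ffun {set T} -> G}.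
have fK : injective f.
  move=> c c' /ffunP e; apply/ffunP => s; have := e s; rewrite !ffunE.
  by move/(congr1 (fun x => x *~ sign_between (o s) (o' s))); rewrite -!mulrzA sq.
rewrite -(card_imset _ fK); apply/subset_leq_card/subsetP => _ /imsetP[c cf ->].
have [cD1 cD2] := flowsP _ _ _ _ cf; apply/flowsP; split=> [s|r rD].
  rewrite ffunE -cD1; congr negb; apply/eqP/eqP => [|->]; last by rewrite mul0rz.
  by move/(congr1 (fun x => x *~ sign_between (o s) (o' s))); rewrite -mulrzA sq mul0rz.
transitivity ((\sum_(s in simplices D k.+1) c s *~ incidence o r s) *~
    sign_between (o r) (o' r));
  last by rewrite cD2 // mul0rz.
rewrite mulrz_suml; apply: eq_bigr => s; rewrite inE => /andP[sD _].
rewrite ffunE -!mulrzA; congr (_ *~ _).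
case: (altP (@exists_inP _ (fun i => i \in s) (fun i => s :\ i == r))) => [[i si /eqP e]|].
  move: rD; rewrite -e inE => /andP[rD _].
  rewrite (incidence_face cD oD sD si) (incidence_face cD oD' sD si).
  have m1 : o s =i o' s by move=> x; rewrite (orients_mem oD sD) (orients_mem oD' sD).
  have m2 : o' s =i i :: o' (s :\ i).
    by move=> x; rewrite inE (orients_mem oD' sD) (orients_mem oD' rD) !inE; case: eqVneq => [->|].
  have m3 : o s =i i :: o (s :\ i).
    by move=> x; rewrite inE (orients_mem oD sD) (orients_mem oD rD) !inE; case: eqVneq => [->|].
  have m4 : i :: o (s :\ i) =i i :: o' (s :\ i) by move=> x; rewrite -m3 -m2 m1.
  (* Both sides are the sign from [o s] to [i :: o' (s :\ i)], computed through [o' s] and through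
     [i :: o (s :\ i)]. *)
  rewrite sign_between_mul // -(sign_between_mul m3 m4); congr (_ * _).
  have u : uniq (i :: o (s :\ i)).
    by rewrite /= (orients_uniq oD rD) andbT (orients_mem oD rD) !inE eqxx.
  rewrite sign_between_cons //= ?eqxx ?mul1r // perm_cons.
  by apply: (perm_orients oD rD); [exact: (orients_uniq oD' rD) | exact: (orients_mem oD' rD)].
rewrite negb_exists_in => /forall_inP h.
by rewrite !incidence_nonface ?mulr0 ?mul0r.
Qed.

Lemma card_flows_orientation (G : finZmodType) (T : finType)
    (D : {set {set T}}) (o o' : {set T} -> seq T) k :
  simplicial_complex D -> orients o D -> orients o' D ->
  #|flows G D o k| = #|flows G D o' k|.
Proof. by move=> *; apply/eqP; rewrite eqn_leq !leq_card_flows_orientation. Qed.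

(* The two hypotheses on sums of incidences say that the boundary of c o p is
   that of c on the ridges h r, and 0 on all other ridges of E. *)
Lemma card_flows_pullback (G : finZmodType) (T U : finType)
    (D : {set {set T}}) (E : {set {set U}})
    (oD : {set T} -> seq T) (oE : {set U} -> seq U) (k : nat)
    (p : {set U} -> {set T}) (h : {set T} -> {set U}) :
  p @: simplices E k.+1 = simplices D k.+1 ->
  (forall c, c \in flows G E oE k ->
     {in simplices E k.+1 &, forall u v, p u = p v -> c u = c v}) ->
  (forall r, r \in simplices D k -> h r \in simplices E k) ->
  (forall r t, r \in simplices D k -> t \in simplices D k.+1 ->
     \sum_(u in simplices E k.+1 | p u == t) incidence oE (h r) u = incidence oD r t) ->
  (forall r t, r \in simplices E k -> t \in simplices D k.+1 ->
     r \notin h @: simplices D k ->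
     \sum_(u in simplices E k.+1 | p u == t) incidence oE r u = 0) ->
  #|flows G E oE k| = #|flows G D oD k|.
Proof.
move=> pE fib hE old new.
pose f (c : {ffun {set T} -> G}) :=
  [ffun u => if u \in simplices E k.+1 then c (p u) else 0] : {ffun {set U} -> G}.
have fsum (c : {ffun {set T} -> G}) r :
    \sum_(u in simplices E k.+1) f c u *~ incidence oE r u =
    \sum_(t in simplices D k.+1)
      c t *~ \sum_(u in simplices E k.+1 | p u == t) incidence oE r u.
  rewrite (partition_big p (mem (simplices D k.+1))) /= => [|u uE]; last first.
    by rewrite -pE imset_f.
  apply: eq_bigr => t _; rewrite mulrz_sumr; apply: eq_bigr => u /andP[uE /eqP <-].
  by rewrite ffunE uE.
have fr (c : {ffun {set T} -> G}) r : r \in simplices D k ->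
    \sum_(u in simplices E k.+1) f c u *~ incidence oE (h r) u =
    \sum_(t in simplices D k.+1) c t *~ incidence oD r t.
  by move=> rD; rewrite fsum; apply: eq_bigr => t tD; rewrite old.
have fflow c : c \in flows G D oD k -> f c \in flows G E oE k.
  move=> /flowsP[c1 c2]; apply/flowsP; split=> [u|r rE].
    by rewrite ffunE; case: ifP => [uE|_]; rewrite ?eqxx // c1 -pE imset_f.
  case: (boolP (r \in h @: simplices D k)) => [/imsetP[r' rD ->]|rN].
    by rewrite fr // c2.
  by rewrite fsum; apply: big1 => t tD; rewrite new // mulr0z.
have -> : flows G E oE k = f @: flows G D oD k.
  apply/eqP; rewrite eqEsubset; apply/andP; split; last first.
    by apply/subsetP => _ /imsetP[c cf ->]; exact: fflow.
  apply/subsetP => c cf; have [c1 c2] := flowsP _ _ _ _ cf.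
  (* For the inverse, any facet in the fibre may be picked, since [fib] makes [c] constant on
     fibres. *)
  pose g : {ffun {set T} -> G} := [ffun t =>
    if [pick u in simplices E k.+1 | p u == t] is Some u then c u else 0].
  have fg : f g = c.
    apply/ffunP => u; rewrite !ffunE; case: ifP => [uE|uN].
      case: pickP => [v /andP[vE /eqP e]|/(_ u)]; last by rewrite uE eqxx.
      exact: fib e.
    by apply/esym/(flow_out cf); rewrite uN.
  apply/imsetP; exists g => //; apply/flowsP; split=> [t|r rD].
    apply/idP/idP; rewrite ffunE.
      by case: pickP => [u /andP[uE /eqP <-] _|]; rewrite ?eqxx // -pE imset_f.
    rewrite -pE => /imsetP[u uE ->].
    by case: pickP => [v /andP[vE _]|/(_ u)]; rewrite ?c1 // uE eqxx.
  by rewrite -fr // fg c2 // hE.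
apply: card_in_imset => c c' cf cf' /ffunP e; apply/ffunP => t.
case: (boolP (t \in simplices D k.+1)) => [|tN]; last first.
  by rewrite (flow_out cf) // (flow_out cf').
by rewrite -pE => /imsetP[u uE ->]; have := e u; rewrite !ffunE uE.
Qed.

(** * Integer flows modulo q and isomorphisms *)

(** [inZp 1] generates the cyclic group of order [q.+1], also when that group is trivial.
    Congruences thereby become equations in the group. *)
Lemma Zp_mulrz_eq0 (q : nat) (z : int) :
  ((inZp 1 : 'I_q.+1) *~ z == 0) = (z == 0 %[mod q.+1%:Z])%Z.
Proof.
have nat_case n : ((inZp 1 : 'I_q.+1) *+ n == 0) = (n%:Z == 0 %[mod q.+1%:Z])%Z.
  rewrite Zp_mulrn -val_eqE /= modz_nat mod0z.
  by rewrite modnMml mul1n.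
case: z => n; first by rewrite -nat_case.
rewrite NegzE mulrNz oppr_eq0 nat_case.
by rewrite !eqz_mod_dvd !subr0 !dvdzE abszN.
Qed.

(** Nowhere-zero vectors, extended by zero off the facets, are exactly the functions whose support
    is the set of facets. *)
Lemma nb_nowhere_zero_flowsE (T : finType) (D : {set {set T}}) o (q k : nat) :
  complex_dim D = k.+1 ->
  nb_nowhere_zero_flows D o q.+1 = #|flows 'I_q.+1 D o k|.
Proof.
move=> dD.
have fE : simplices D k.+1 = facets D by rewrite /facets dD.
have rE : simplices D k = ridges D by rewrite /ridges dD.
pose f (c : {ffun {set T} -> 'I_q.+1}) : 'cV['I_q.+1]_#|facets D| :=
  \col_j c (enum_val j).
(* The sum has one term when [s] is a facet and is empty otherwise: this is extension by zero. *)
pose g (phi : 'cV['I_q.+1]_#|facets D|) : {ffun {set T} -> 'I_q.+1} :=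
  [ffun s => \sum_(j | enum_val j == s) phi j ord0].
have gE phi j : g phi (enum_val j) = phi j ord0.
  rewrite ffunE (big_pred1 j) // => i; exact: (inj_eq enum_val_inj).
have fg phi : f (g phi) = phi by apply/colP => j; rewrite mxE gE.
have is_flowE phi : is_flow o phi =
    [forall r in ridges D,
      \sum_(s in facets D) g phi s *~ incidence o r s == 0].
  have toZ (x : 'I_q.+1) : x = inZp 1 *~ (nat_of_ord x)%:Z.
    by apply: val_inj; rewrite /= -pmulrn Zp_mulrn /= modnMml mul1n modn_small.
  have row i : ((boundary D o *m
       map_mx (fun x : 'I_q.+1 => (nat_of_ord x)%:Z) phi) i ord0
         == 0 %[mod q.+1%:Z])%Z =
      (\sum_(s in facets D) g phi s *~ incidence o (enum_val i) s == 0).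
    rewrite -Zp_mulrz_eq0 mxE mulrz_sumr; congr (_ == _).
    rewrite [RHS]big_enum_val /=; apply: eq_bigr => j _.
    by rewrite gE !mxE [phi j ord0 in RHS]toZ -mulrzA mulrC.
  apply/forallP/forall_inP => [h r rD|h i].
    by rewrite -(enum_rankK_in rD rD) -row.
  by rewrite row; apply: h; exact: enum_valP.
rewrite /nb_nowhere_zero_flows.
have -> : [set phi : 'cV['I_q.+1]_#|facets D| | is_flow o phi & nowhere_zero phi]
    = f @: flows 'I_q.+1 D o k.
  apply/eqP; rewrite eqEsubset; apply/andP; split; apply/subsetP.
    move=> phi; rewrite inE => /andP[fl /forallP nz]; apply/imsetP.
    exists (g phi) => //; apply/flowsP; rewrite fE rE; split => [s|r rD].
      apply/idP/idP => [|sD].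
        apply: contraR => sN; rewrite ffunE big_pred0 // => j.
        by apply/negP => /eqP e; move: sN; rewrite -e enum_valP.
      by have := nz (enum_rank_in sD s); rewrite -gE enum_rankK_in.
    by move: fl; rewrite is_flowE => /forall_inP /(_ r rD) /eqP.
  move=> _ /imsetP[c cf ->]; have := cf => /flowsP; rewrite fE rE => -[c1 c2].
  have gf : g (f c) = c.
    apply/ffunP => s; case: (boolP (s \in facets D)) => sD.
      by rewrite -(enum_rankK_in sD sD) gE mxE.
    rewrite (flow_out cf) ?fE // ffunE big_pred0 // => j.
    by apply/negP => /eqP e; move: sD; rewrite -e enum_valP.
  rewrite inE is_flowE gf; apply/andP; split.
    by apply/forall_inP => r rD; rewrite c2.
  by apply/forallP => j; rewrite mxE; have := c1 (enum_val j); rewrite enum_valP.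
apply: card_in_imset => c c' cf cf' e; apply/ffunP => s.
case: (boolP (s \in facets D)) => sD; last first.
  by rewrite (flow_out cf) ?fE // (flow_out cf') ?fE.
by have /matrixP/(_ (enum_rank_in sD s) ord0) := e; rewrite !mxE enum_rankK_in.
Qed.

(** * Isomorphic complexes *)

Lemma orients_enum (T : finType) (D : {set {set T}}) :
  orients (fun s : {set T} => enum s) D.
Proof. by []. Qed.

Lemma face_vertices (T : finType) (D : {set {set T}}) (s : {set T}) :
  simplicial_complex D -> s \in D -> {subset s <= vertices D}.
Proof. by move=> cD sD x xs; rewrite inE; apply: (cD.2 s) => //; rewrite sub1set. Qed.

(** Outside the vertices [f] is arbitrary, so the preimage must be cut down to the vertices to give
    back [s]. *)
Lemma vertices_imsetK (T U : finType) (D : {set {set T}}) (f : T -> U) (s : {set T}) :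
  simplicial_complex D -> {in vertices D &, injective f} -> s \in D ->
  [set x in vertices D | f x \in f @: s] = s.
Proof.
move=> cD finj sD; have vs := face_vertices cD sD.
apply/setP => x; rewrite inE; apply/andP/idP => [[xD /imsetP[y ys /finj ->]] //|xs].
  exact: vs.
by rewrite vs // imset_f.
Qed.

Lemma imset_setD1 (T U : finType) (f : T -> U) (s : {set T}) i :
  i \in s -> {in s &, injective f} -> (f @: s) :\ f i = f @: (s :\ i).
Proof.
move=> si finj; apply/setP => y; rewrite !inE; apply/andP/imsetP.
  move=> [yi /imsetP[x xs e]]; exists x => //; rewrite !inE xs andbT.
  by apply: contraNneq yi => <-; rewrite e.
move=> [x]; rewrite !inE => /andP[xi xs] ->; split; last exact: imset_f.
by apply: contraNneq xi => /finj ->.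
Qed.

(** When the orderings of both simplices are carried over by [f], the signs agree by
    [sign_between_map]. A pair that is not incident stays so, because faces are recovered from their
    images. *)
Lemma incidence_imset (T U : finType) (D : {set {set T}}) (E : {set {set U}})
    (oD : {set T} -> seq T) (oE : {set U} -> seq U) (f : T -> U) (r s : {set T}) :
  simplicial_complex D -> orients oD D -> simplicial_complex E -> orients oE E ->
  r \in D -> s \in D -> f @: s \in E -> {in vertices D &, injective f} ->
  oE (f @: r) = map f (oD r) -> oE (f @: s) = map f (oD s) ->
  incidence oE (f @: r) (f @: s) = incidence oD r s.
Proof.
move=> cD oDD cE oEE rD sD fsE finj oEr oEs.
have finj_s : {in s &, injective f}.
  by move=> x y xs ys; apply: finj; rewrite (face_vertices cD sD).
case: (altP (@exists_inP _ (fun i => i \in s) (fun i => s :\ i == r))) => [[i si /eqP e]|].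
  have re : f @: r = (f @: s) :\ f i by rewrite imset_setD1 // e.
  rewrite re -[in RHS]e (incidence_face cE oEE) ?imset_f // (incidence_face cD oDD) //.
  rewrite -re e oEr oEs -map_cons sign_between_map //.
  - exact: orients_uniq oDD _ sD.
  - apply: (perm_orients oDD sD) => [|x] /=.
      by rewrite (orients_uniq oDD rD) (orients_mem oDD rD) -e !inE eqxx.
    by rewrite inE (orients_mem oDD rD) -e !inE; case: eqVneq => [->|].
  - by move=> x y; rewrite !(orients_mem oDD sD); exact: finj_s.
rewrite negb_exists_in => /forall_inP h.
rewrite !incidence_nonface // => _ /imsetP[i si ->].
rewrite imset_setD1 //; apply: contra (h i si) => /eqP e.
by rewrite -(vertices_imsetK cD finj (simplexD1 cD i sD)) e (vertices_imsetK cD finj rD).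
Qed.

Lemma card_flows_isomorphic (G : finZmodType) (T U : finType)
    (D : {set {set T}}) (E : {set {set U}}) oD oE k :
  simplicial_complex D -> simplicial_complex E ->
  orients oD D -> orients oE E -> isomorphic D E ->
  #|flows G E oE k| = #|flows G D oD k|.
Proof.
move=> cD cE oDD oEE [f [finj fDE]].
have finj_s s : s \in D -> {in s &, injective f}.
  by move=> sD x y xs ys; apply: finj; exact: (face_vertices cD sD).
pose p (u : {set U}) := [set x in vertices D | f x \in u].
have pK s : s \in D -> p (f @: s) = s by exact: vertices_imsetK.
have imE s k' : s \in simplices D k' -> f @: s \in simplices E k'.
  rewrite !inE -fDE => /andP[sD sk]; rewrite imset_f //=.
  by rewrite card_in_imset //; exact: finj_s.
have Eim u k' : u \in simplices E k' -> exists2 s, s \in simplices D k' & u = f @: s.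
  rewrite inE -fDE => /andP[/imsetP[s sD ->] uk]; exists s => //.
  by rewrite inE sD -(card_in_imset (finj_s s sD)).
(* As the count does not depend on the orientation, [E] may carry the one transported from [D];
   incidences are then equal and all fibres are singletons. *)
pose oE' u := map f (oD (p u)).
have oEE' : orients oE' E.
  move=> u; rewrite -fDE => /imsetP[s sD ->]; rewrite /oE' pK //.
  apply: uniq_perm; rewrite ?enum_uniq //.
    rewrite map_inj_in_uniq ?(orients_uniq oDD) // => x y.
    by rewrite !(orients_mem oDD sD); exact: finj_s.
  move=> y; rewrite mem_enum; apply/mapP/imsetP => -[x xs ->]; exists x => //.
    by rewrite -(orients_mem oDD sD).
  by rewrite (orients_mem oDD sD).
rewrite (card_flows_orientation _ _ cE oEE oEE').
have inD s k' : s \in simplices D k' -> s \in D by rewrite inE => /andP[].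
apply: (@card_flows_pullback _ _ _ _ _ _ _ _ p (fun s => f @: s)).
- apply/setP => s; apply/imsetP/idP => [[u /Eim[t tD ->] ->]|sD].
    by rewrite pK // (inD _ _ tD).
  by exists (f @: s); [exact: imE | rewrite pK // (inD _ _ sD)].
- move=> c _ u v /Eim[s sD ->] /Eim[t tD ->].
  by rewrite !pK ?(inD _ _ sD) ?(inD _ _ tD) // => ->.
- by move=> r; exact: imE.
- move=> r t rD tD; rewrite (big_pred1 (f @: t)) => [|u /=].
    have [rC tC] := (inD _ _ rD, inD _ _ tD).
    apply: (incidence_imset cD oDD cE oEE') => //; first by rewrite -fDE imset_f.
      by rewrite /oE' pK.
    by rewrite /oE' pK.
  apply/andP/eqP => [[/Eim[s sD ->] /eqP <-]|->].
    by rewrite pK ?(inD _ _ sD).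
  by rewrite imE // pK ?(inD _ _ tD) ?eqxx.
- by move=> r t /Eim[s sD ->] _ /negP[]; exact: imset_f.
Qed.

(** * Subdivisions *)

Lemma simplices_sub (T : finType) (D : {set {set T}}) n :
  {subset simplices D n <= D}.
Proof. by move=> s; rewrite inE => /andP[]. Qed.

Section Subdivision.
Variables (T : finType) (D : {set {set T}}) (s : {set T}) (k : nat).
Hypotheses (cD : simplicial_complex D) (sD : s \in D) (sk : #|s| = k.+2)
  (Dmax : forall t, t \in D -> (#|t| <= k.+2)%N).
Let E := subdivision D s.

(** * Faces of the subdivision: old faces and cones over the apex *)

Definition cone (t : {set T}) : {set option T} := None |: Some @: t.

Lemma SomeK (t : {set T}) : Some @^-1: (Some @: t) = t.
Proof. by apply/setP => x; rewrite inE mem_imset //; exact: Some_inj. Qed.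

Lemma None_Some (t : {set T}) : (None \in Some @: t) = false.
Proof. by apply/imsetP => -[]. Qed.

Lemma mem_Some (t : {set T}) x : (Some x \in Some @: t) = (x \in t).
Proof. by rewrite mem_imset //; exact: Some_inj. Qed.

Lemma option_setE (u : {set option T}) :
  u = if None \in u then cone (Some @^-1: u) else Some @: (Some @^-1: u).
Proof.
apply/setP => -[x|].
  by case: ifP => _; rewrite ?in_setU1 ?mem_Some inE.
by case: ifP => h; rewrite ?None_Some // in_setU1.
Qed.

Lemma card_Some (t : {set T}) : #|Some @: t| = #|t|.
Proof. by rewrite card_imset //; exact: Some_inj. Qed.

Lemma card_cone (t : {set T}) : #|cone t| = #|t|.+1.
Proof. by rewrite cardsU1 None_Some card_Some. Qed.

Lemma coneD1 (t : {set T}) j : cone t :\ Some j = cone (t :\ j).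
Proof.
by apply/setP => -[x|]; rewrite !inE ?mem_Some ?inE.
Qed.

Lemma coneDNone (t : {set T}) : cone t :\ None = Some @: t.
Proof. by apply/setP => -[x|]; rewrite !inE ?mem_Some ?None_Some. Qed.

Lemma sub_cone (t t' : {set T}) : (cone t \subset cone t') = (t \subset t').
Proof.
apply/subsetP/subsetP => h x; first by have := h (Some x); rewrite !inE !mem_Some.
by case: x => [x|]; rewrite !inE //= !mem_Some; exact: h.
Qed.

Lemma sub_Some_cone (t t' : {set T}) : (Some @: t \subset cone t') = (t \subset t').
Proof.
apply/subsetP/subsetP => h x; first by have := h (Some x); rewrite !inE !mem_Some.
by case: x => [x|]; rewrite ?None_Some // !inE /= !mem_Some; exact: h.
Qed.

(** A face of a new facet that avoids the apex is a proper subset of [s], hence already an old face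
    other than [s]. *)
Lemma Some_subdivision (t : {set T}) : (Some @: t \in E) = (t \in D :\ s).
Proof.
rewrite inE mem_imset; last exact: imset_inj Some_inj.
apply/orP/idP => [[//|]|]; last by left.
rewrite inE => /exists_inP[i si]; rewrite sub_Some_cone => ti; rewrite in_setD1.
apply/andP; split; last by apply: (cD.2 s) => //; apply: subset_trans ti (subsetDl _ _).
by apply: contraTneq ti => ->; apply/subsetPn; exists i; rewrite // !inE eqxx.
Qed.

Lemma cone_subdivision (t : {set T}) : (cone t \in E) = (t \proper s).
Proof.
rewrite inE; apply/orP/idP => [[/imsetP[t' _ e]|]|/properP[ts [i si ti]]].
- by have := setU11 None (Some @: t); rewrite -/(cone t) e None_Some.
- rewrite inE => /exists_inP[i si]; rewrite sub_cone => /subsetD1P[ts ti].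
  by apply/properP; split=> //; exists i.
- by right; rewrite inE; apply/exists_inP; exists i; rewrite // sub_cone; apply/subsetD1P.
Qed.

Lemma subdivision_complex : simplicial_complex E.
Proof.
split=> [|u v].
  by rewrite -(imset0 Some) Some_subdivision !inE cD.1 andbT eq_sym -card_gt0 sk.
rewrite [u]option_setE [v]option_setE.
set u' := _ @^-1: u; set v' := _ @^-1: v.
case: (boolP (None \in u)) => _; case: (boolP (None \in v)) => _.
- rewrite !cone_subdivision sub_cone => h1 h2; exact: sub_proper_trans h2 h1.
- rewrite cone_subdivision Some_subdivision sub_Some_cone => h1 h2.
  have h := sub_proper_trans h2 h1.
  by rewrite in_setD1 proper_neq // (cD.2 s) // proper_sub.
- by move=> _ /subsetP/(_ None); rewrite None_Some !inE => /(_ isT).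
- rewrite !Some_subdivision !in_setD1 => /andP[us uD] h.
  have vu : v' \subset u'.
    by apply/subsetP => x; have := subsetP h (Some x); rewrite !mem_Some.
  (* Deleting [s] keeps the family closed under subsets: by [Dmax], a face containing [s] is [s]
     itself. *)
  rewrite (cD.2 u') // andbT; apply: contraNneq us => vs.
  by rewrite eq_sym eqEcard -{1}vs vu sk Dmax.
Qed.

Lemma Some_simplices (t : {set T}) n :
  (Some @: t \in simplices E n) = (t != s) && (t \in simplices D n).
Proof. by rewrite [LHS]inE Some_subdivision card_Some in_setD1 !inE andbA. Qed.

Lemma cone_facet i : i \in s -> cone (s :\ i) \in simplices E k.+1.
Proof.
move=> si; rewrite inE cone_subdivision properD1 // card_cone eqSS /=.
by move: sk; rewrite (cardsD1 i) si add1n => -[->].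
Qed.

Lemma cone_ridge i j : i \in s -> j \in s -> i != j ->
  cone (s :\ i :\ j) \in simplices E k.
Proof.
move=> si sj ij; rewrite inE cone_subdivision card_cone.
rewrite (sub_proper_trans (subsetDl _ _)) ?properD1 //=.
by move: sk; rewrite (cardsD1 i) si (cardsD1 j) !inE sj eq_sym ij !add1n => -[->].
Qed.

Lemma cone_facetP (t : {set T}) : cone t \in simplices E k.+1 ->
  exists2 i, i \in s & t = s :\ i.
Proof.
rewrite inE cone_subdivision card_cone eqSS => /andP[/properP[ts [i si ti]] /eqP tk].
exists i => //; apply/eqP; rewrite eqEcard; apply/andP; split; first exact/subsetD1P.
by move: sk; rewrite (cardsD1 i) si tk add1n => -[->].
Qed.

Lemma cone_ridgeP (t : {set T}) : cone t \in simplices E k ->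
  exists i j, [/\ i \in s, j \in s, i != j & t = s :\ i :\ j].
Proof.
rewrite inE cone_subdivision card_cone eqSS => /andP[/properP[ts [i si ti]] /eqP tk].
have tsi : t \subset s :\ i by apply/subsetD1P.
have ci : #|s :\ i| = k.+1 by move: sk; rewrite (cardsD1 i) si add1n => -[].
have /properP[_ [j]] : t \proper s :\ i by rewrite properEcard tsi tk ci leqnn.
rewrite !inE => /andP[ji sj] tj; exists i, j; split; rewrite // 1?eq_sym //.
apply/eqP; rewrite eqEcard; apply/andP; split; first exact/subsetD1P.
by move: ci; rewrite (cardsD1 j) !inE ji sj tk add1n => -[->].
Qed.

(** * Orientation of the subdivision *)

Variable oD : {set T} -> seq T.
Hypothesis oDD : orients oD D.

(* On a new facet, the apex takes the place of the vertex it replaces. *)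
Definition subdivision_orientation (u : {set option T}) : seq (option T) :=
  let w := [seq if Some x \in u then Some x else None | x <- oD s] in
  if None \in u then if perm_eq w (enum u) then w else enum u
  else map Some (oD (Some @^-1: u)).
Let oE := subdivision_orientation.

(** Restricted to [s], this identifies [s] with the new facet [cone (s :\ i)], and the ordering of
    that facet is transported along it. *)
Definition apex_for (i x : T) : option T := if x == i then None else Some x.

Lemma apex_for_inj i : injective (apex_for i).
Proof.
move=> x y; rewrite /apex_for; case: (eqVneq x i) => [->|_]; case: (eqVneq y i) => [->|_] //.
by case.
Qed.

Lemma map_apex_for i (l : seq T) : i \notin l -> map (apex_for i) l = map Some l.
Proof.
move=> il; apply/eq_in_map => x xl; rewrite /apex_for; case: eqVneq => // xi.
by move: il; rewrite -xi xl.
Qed.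

Lemma subdivision_orientation_Some (t : {set T}) : oE (Some @: t) = map Some (oD t).
Proof. by rewrite /oE /subdivision_orientation None_Some SomeK. Qed.

(** On a new facet exactly one vertex of [s] is missing, so the word [w] has no repetition and the
    first branch is taken. *)
Lemma subdivision_orientation_cone i : i \in s ->
  oE (cone (s :\ i)) = map (apex_for i) (oD s).
Proof.
move=> si; rewrite /oE /subdivision_orientation setU11.
have -> : [seq if Some x \in cone (s :\ i) then Some x else None | x <- oD s] =
    map (apex_for i) (oD s).
  apply/eq_in_map => x; rewrite (orients_mem oDD sD) => xs.
  by rewrite !inE mem_Some !inE xs andbT orFb /apex_for; case: (eqVneq x i).
rewrite ifT //; apply: uniq_perm; rewrite ?enum_uniq //.
  by rewrite (map_inj_uniq (@apex_for_inj i)) (orients_uniq oDD sD).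
move=> y; rewrite mem_enum; apply/mapP/idP => [[x + ->]|].
  rewrite (orients_mem oDD sD) => xs; rewrite /apex_for; case: eqVneq => xi.
    exact: setU11.
  by rewrite !inE mem_Some !inE xi xs.
case: y => [y|_]; last by exists i; rewrite ?(orients_mem oDD sD) // /apex_for eqxx.
rewrite !inE mem_Some !inE /= => /andP[yi ys].
by exists y; rewrite ?(orients_mem oDD sD) // /apex_for (negPf yi).
Qed.

Lemma subdivision_orients : orients oE E.
Proof.
move=> u; rewrite [u]option_setE; set t := _ @^-1: u; case: ifP => _.
  by rewrite cone_subdivision /oE /subdivision_orientation setU11 => _; case: ifP.
rewrite Some_subdivision subdivision_orientation_Some in_setD1 => /andP[_ tD].
apply: uniq_perm; rewrite ?enum_uniq //.
  by rewrite (map_inj_uniq Some_inj) (orients_uniq oDD tD).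
by case=> [x|]; rewrite mem_enum ?mem_Some ?None_Some ?(mem_map Some_inj) ?(orients_mem oDD tD) //;
  apply/mapP => -[].
Qed.

(** * Incidence numbers in the subdivision *)

Let cE := subdivision_complex.
Let oEE := subdivision_orients.

(** The map [apex_for i] fixes [s :\ i] and sends [i] to the apex, so it carries the sign for [s] to
    the sign for the new facet. The only face of that facet without the apex is [s :\ i]. *)
Lemma incidence_old_cone (r : {set T}) i : r \in D -> i \in s ->
  incidence oE (Some @: r) (cone (s :\ i)) =
  if s :\ i == r then incidence oD r s else 0.
Proof.
move=> rD si; have ciE := simplices_sub (cone_facet si).
case: eqVneq => [<-|ne].
  rewrite -[in LHS]coneDNone (incidence_face cE oEE) ?setU11 //.
  rewrite coneDNone subdivision_orientation_cone // subdivision_orientation_Some.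
  have rD' : s :\ i \in D by rewrite simplexD1.
  rewrite (incidence_face cD oDD) // -(@map_apex_for i) ?(orients_mem oDD rD') ?setD11 //.
  have -> : None = apex_for i i by rewrite /apex_for eqxx.
  rewrite -map_cons sign_between_map ?(orients_uniq oDD) //; last exact: in2W (@apex_for_inj i).
  apply: (perm_orients oDD sD) => [|x] /=.
    by rewrite (orients_uniq oDD rD') (orients_mem oDD rD') !inE eqxx.
  by rewrite inE (orients_mem oDD rD') !inE; case: eqVneq => [->|].
apply: incidence_nonface => -[x|] _.
  rewrite coneD1; apply/eqP => e; have := setU11 None (Some @: (s :\ i :\ x)).
  by rewrite -/(cone _) e None_Some.
by rewrite coneDNone (inj_eq (imset_inj Some_inj)).
Qed.

(** Pulled back to [s], the two incidences compare [oD s] with orderings that differ by exchanging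
    [i] and [j]; hence the opposite signs. *)
Lemma incidence_cone_swap i j : i \in s -> j \in s -> i != j ->
  incidence oE (cone (s :\ i :\ j)) (cone (s :\ i)) =
  - incidence oE (cone (s :\ i :\ j)) (cone (s :\ j)).
Proof.
pose w := enum (s :\ i :\ j) => si sj ij.
(* This factor depends on the ridge alone and is common to both facets. *)
pose e := sign_between (None :: map Some w) (oE (cone (s :\ i :\ j))).
have rE := simplices_sub (cone_ridge si sj ij).
(* Here [a] is the vertex replaced by the apex and [b] the one removed to reach the ridge. *)
suff gen a b : a \in s -> b \in s -> a != b -> s :\ i :\ j = s :\ a :\ b ->
    incidence oE (cone (s :\ i :\ j)) (cone (s :\ a)) =
    sign_between (oD s) (b :: a :: w) * e.
  rewrite (gen i j) // (gen j i) 1?eq_sym //; last by rewrite !setDDl setUC.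
  rewrite sign_between_swap ?mulNr // ?(orients_uniq oDD) //.
  apply: (perm_orients oDD sD) => [|x] /=.
    by rewrite enum_uniq !inE !mem_enum !inE !eqxx /= orbF andbF /= andbT eq_sym ij.
  rewrite !inE mem_enum !inE; case: (eqVneq x j) => [->|_]; first by rewrite sj.
  by case: (eqVneq x i) => [->|_]; rewrite ?si.
move=> sa sb ab eab; have ba : b != a by rewrite eq_sym.
have aE := simplices_sub (cone_facet sa).
rewrite eab -coneD1 (incidence_face cE oEE) //; last by rewrite !inE mem_Some !inE sb ba.
rewrite coneD1 -eab subdivision_orientation_cone //.
have uw : uniq [:: b, a & w].
  by rewrite /= enum_uniq !inE !mem_enum eab !inE !eqxx /= orbF andbF /= andbT eq_sym ab.
have mw : [:: b, a & w] =i s.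
  move=> x; rewrite !inE mem_enum eab !inE.
  case: (eqVneq x b) => [->|_]; first by rewrite sb.
  by case: (eqVneq x a) => [->|_]; rewrite ?sa.
have ea : apex_for a a = None by rewrite /apex_for eqxx.
have eb : apex_for a b = Some b by rewrite /apex_for (negPf ba).
have pw := perm_orients oDD sD uw mw.
rewrite -(sign_between_map _ pw (in2W (@apex_for_inj a))) ?(orients_uniq oDD) //=.
rewrite eb ea (@map_apex_for _ w); last first.
  by rewrite mem_enum eab !inE eqxx andbF.
have mo : None :: map Some w =i oE (cone (s :\ i :\ j)).
  move=> y; rewrite (orients_mem oEE rE) !inE; case: y => [y|] //=.
  by rewrite (mem_map Some_inj) mem_Some mem_enum.
(* Putting the same element in front of both orderings leaves the sign unchanged. *)
have -> : e = sign_between [:: Some b, None & map Some w] (Some b :: oE (cone (s :\ i :\ j))).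
  rewrite sign_between_cons /= ?eqxx ?mul1r //.
    rewrite inE (mem_map Some_inj) mem_enum eab !inE eqxx /=.
    by rewrite (map_inj_uniq Some_inj) enum_uniq andbT; apply/mapP => -[].
  rewrite perm_cons perm_sym; apply: (perm_orients oEE rE) => [|y].
    rewrite /= (map_inj_uniq Some_inj) enum_uniq andbT; apply/mapP => -[//].
  by rewrite mo (orients_mem oEE rE).
rewrite sign_between_mul // => y; last by rewrite in_cons mo [RHS]in_cons.
by have := perm_mem (perm_map (apex_for a) pw) y; rewrite /= eb ea (@map_apex_for _ w) //
  mem_enum eab !inE eqxx andbF.
Qed.

(** A facet containing this ridge contains the apex, so it is [cone (s :\ l)]; for [l] other than
    [i] and [j], the ridge contains [l] but the facet does not. *)
Lemma incidence_cone_other i j u : i \in s -> j \in s -> u \in simplices E k.+1 ->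
  u != cone (s :\ i) -> u != cone (s :\ j) ->
  incidence oE (cone (s :\ i :\ j)) u = 0.
Proof.
move=> si sj; rewrite [u]option_setE; set t := _ @^-1: u; case: ifP => _ uE ui uj.
  have [l sl tl] := cone_facetP uE; rewrite tl in ui uj *.
  apply: incidence_nonface => -[x|_]; last first.
    rewrite coneDNone; apply/eqP => e; have := None_Some (s :\ l).
    by rewrite e setU11.
  rewrite coneD1 => _; apply/eqP => /(congr1 (fun A : {set option T} => Some l \in A)).
  rewrite !inE !mem_Some !inE eqxx sl andbF /= andbT.
  case: (eqVneq l j) uj => [->|_ _]; first by rewrite eqxx.
  by case: (eqVneq l i) ui => [->|]; rewrite ?eqxx.
apply: incidence_nonface => y _; apply/eqP => e.
have : None \in cone (s :\ i :\ j) by exact: setU11.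
by rewrite -e in_setD1 None_Some andbF.
Qed.

(** * Flows on the subdivision *)

(** The smallest old face containing [u] geometrically; the apex is interior to [s], so every face
    through it has carrier [s]. *)
Definition carrier (u : {set option T}) : {set T} :=
  if None \in u then s else Some @^-1: u.

Lemma carrier_cone (t : {set T}) : carrier (cone t) = s.
Proof. by rewrite /carrier setU11. Qed.

Lemma carrier_Some (t : {set T}) : carrier (Some @: t) = t.
Proof. by rewrite /carrier None_Some SomeK. Qed.

Lemma facet_subdivisionP u : u \in simplices E k.+1 ->
  (exists2 i, i \in s & u = cone (s :\ i)) \/
  (exists t, [/\ t \in simplices D k.+1, t != s & u = Some @: t]).
Proof.
rewrite [u]option_setE; set t := _ @^-1: u; case: ifP => _.
  by move/cone_facetP=> [i si ->]; left; exists i.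
by rewrite Some_simplices => /andP[ts tD]; right; exists t.
Qed.

(** Flows are pulled back along [carrier]: the fibre over [s] consists of the new facets, and every
    other fibre is a single old facet. *)
Lemma card_flows_subdivision (G : finZmodType) :
  #|flows G E oE k| = #|flows G D oD k|.
Proof.
have sF : s \in simplices D k.+1 by rewrite inE sD sk eqxx.
have ridge_neq r : r \in simplices D k -> r != s.
  by rewrite inE => /andP[_ /eqP rk]; apply: contra_eqN rk => /eqP ->; rewrite sk; lia.
have inj_cone : {in s &, injective (fun i => cone (s :\ i))}.
  move=> i j si sj /(congr1 (fun A : {set option T} => Some i \in A)).
  by rewrite !inE !mem_Some !inE eqxx si /= !andbT => h; apply/eqP/negbFE; rewrite -h.
have fiber_s : [set u in simplices E k.+1 | carrier u == s] =
    [set cone (s :\ i) | i in s].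
  apply/setP => u; rewrite [LHS]inE; apply/andP/imsetP => [[uE]|[i si ->]].
    case: (facet_subdivisionP uE) => [[i si ->] _|[t [_ ts ->]]]; first by exists i.
    by rewrite carrier_Some (negPf ts).
  by rewrite cone_facet // carrier_cone.
have sum_s (F : {set option T} -> int) :
    \sum_(u in simplices E k.+1 | carrier u == s) F u = \sum_(i in s) F (cone (s :\ i)).
  transitivity (\sum_(u in [set cone (s :\ i) | i in s]) F u); last by rewrite big_imset.
  by rewrite -fiber_s; apply: eq_bigl => u; rewrite [RHS]inE.
have sum_t t (F : {set option T} -> int) : t \in simplices D k.+1 -> t != s ->
    \sum_(u in simplices E k.+1 | carrier u == t) F u = F (Some @: t).
  move=> tD ts; apply: big_pred1 => u /=; apply/andP/eqP => [[uE]|->].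
    case: (facet_subdivisionP uE) => [[i si ->]|[t' [_ _ ->]]].
      by rewrite carrier_cone eq_sym (negPf ts).
    by rewrite carrier_Some => /eqP->.
  by rewrite Some_simplices ts tD carrier_Some.
apply: (@card_flows_pullback _ _ _ _ _ _ _ _ carrier (fun r => Some @: r)).
- apply/setP => t; apply/imsetP/idP => [[u uE ->]|tD].
    case: (facet_subdivisionP uE) => [[i si ->]|[t' [? ? ->]]].
      by rewrite carrier_cone.
    by rewrite carrier_Some.
  case: (eqVneq t s) => [->|ts].
    have /card_gt0P[i si] : (0 < #|s|)%N by rewrite sk.
    by exists (cone (s :\ i)); rewrite ?cone_facet ?carrier_cone.
  by exists (Some @: t); rewrite ?carrier_Some // Some_simplices ts.
- move=> c /flowsP[_ cflow] u v uE vE.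
  case: (facet_subdivisionP uE) => [[i si eu]|[t [_ ts eu]]];
    case: (facet_subdivisionP vE) => [[j sj ev]|[t' [_ ts' ev]]];
    rewrite eu ev ?carrier_cone ?carrier_Some.
  (* The flow equation at the ridge opposite [i] and [j] has only two terms, with opposite
     incidences, so the two values agree. *)
  + move=> _; case: (eqVneq i j) => [->//|ij].
    have := cflow _ (cone_ridge si sj ij).
    have vu : v != u by apply: contra_neq ij => e; apply: inj_cone => //; rewrite -eu -ev.
    rewrite (bigD1 u) //= (bigD1 v) /=; last by rewrite vE.
    rewrite big1 ?addr0 => [|x /andP[/andP[xE xu] xv]]; last first.
      by rewrite incidence_cone_other ?mulr0z // -?eu -?ev.
    rewrite eu ev incidence_cone_swap // mulrNz => /eqP.
    rewrite addrC subr_eq0 => /eqP/esym.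
    have -> : s :\ i :\ j = s :\ j :\ i by rewrite !setDDl setUC.
    rewrite -(coneD1 (s :\ j)) (incidence_face cE oEE) ?(simplices_sub (cone_facet sj)) //;
      last first.
      by rewrite !inE mem_Some !inE ij si.
    (* The common incidence number is a sign, and multiplying by it again cancels it. *)
    move/(congr1 (fun x => x *~ sign_between (oE (cone (s :\ j)))
        (Some i :: oE (cone (s :\ j) :\ Some i)))).
    by rewrite -!mulrzA sign_between_sqr.
  + by move=> e; rewrite e eqxx in ts'.
  + by move=> e; rewrite e eqxx in ts.
  + by move=> ->.
- by move=> r rD; rewrite Some_simplices rD ridge_neq.
- move=> r t rR tF; have rD := simplices_sub rR.
  have tD := simplices_sub tF.
  case: (eqVneq t s) => [->|ts].
    (* Among the new facets, at most the one with [s :\ i] equal to [r] contributes, and it does so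
       with the incidence of [r] in [s]. *)
    rewrite sum_s (eq_bigr _ (fun i si => incidence_old_cone rD si)) -big_mkcondr /=.
    case: (altP (@exists_inP _ (fun i => i \in s) (fun i => s :\ i == r))) => [[i si /eqP e]|].
      rewrite (big_pred1 i) // => j /=; apply/andP/eqP => [[sj /eqP ej]|->].
        by apply: inj_cone => //; rewrite /= e ej.
      by rewrite e.
    rewrite negb_exists_in => /forall_inP h.
    by rewrite big_pred0 ?incidence_nonface // => i; case: (boolP (i \in s)) => //= /h/negPf.
  rewrite sum_t //; apply: (incidence_imset cD oDD cE oEE) => //.
  + by rewrite Some_subdivision in_setD1 ts.
  + by move=> x y _ _; exact: Some_inj.
  + exact: subdivision_orientation_Some.
  + exact: subdivision_orientation_Some.
move=> r t; rewrite [r]option_setE; set r' := _ @^-1: r; case: ifP => _; last first.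
  rewrite Some_simplices => /andP[_ rD] _ /imsetP[]; by exists r'.
move=> /cone_ridgeP[i [j [si sj ij ->]]] tD _.
case: (eqVneq t s) => [->|ts].
  (* A ridge through the apex lies in two new facets, whose incidences cancel. *)
  rewrite sum_s (bigD1 i) //= (bigD1 j) /=; last by rewrite sj eq_sym.
  rewrite incidence_cone_swap // addrA addNr add0r; apply: big1 => l /andP[/andP[sl li] lj].
  apply: incidence_cone_other; rewrite ?cone_facet //.
    by apply: contra_neq li => /inj_cone ->.
  by apply: contra_neq lj => /inj_cone ->.
have tE : Some @: t \in simplices E k.+1 by rewrite Some_simplices ts.
rewrite sum_t // incidence_cone_other //.
  by apply/eqP => /(congr1 carrier)/eqP; rewrite carrier_Some carrier_cone (negPf ts).
by apply/eqP => /(congr1 carrier)/eqP; rewrite carrier_Some carrier_cone (negPf ts).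
Qed.

End Subdivision.

(** * Refinements *)

(** In positive dimension the predecessor in [complex_dim] is not truncated, so the largest
    cardinality is [n.+2]. *)
Lemma card_le_dim (T : finType) (D : {set {set T}}) n t :
  complex_dim D = n.+1 -> t \in D -> (#|t| <= n.+2)%N.
Proof.
rewrite /complex_dim => dD tD.
have := @leq_bigmax_cond _ (mem D) (fun u : {set T} => #|u|) t tD.
by move: dD; case: (\max_(u in D) #|u|)%N => // m /= ->.
Qed.

(** A new facet has as many vertices as [s], so the dimension is kept even if [s] was the only
    facet. *)
Lemma complex_dim_subdivision (T : finType) (D : {set {set T}}) (s : {set T}) k :
  simplicial_complex D -> complex_dim D = k.+1 -> s \in facets D ->
  complex_dim (subdivision D s) = k.+1.
Proof.
move=> cD dD; rewrite /facets dD inE => /andP[sD /eqP sk].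
have /card_gt0P[i si] : (0 < #|s|)%N by rewrite sk.
have := cone_facet D sk si; rewrite inE => /andP[cE /eqP ck].
suff -> : complex_dim (subdivision D s) = (k.+2).-1 by [].
congr predn; apply/eqP; rewrite eqn_leq; apply/andP; split; last first.
  by rewrite -ck; apply: (@leq_bigmax_cond _ (mem (subdivision D s))
    (fun u : {set option T} => #|u|)).
apply/bigmax_leqP => u; rewrite [u]option_setE; set t := _ @^-1: u; case: ifP => _.
  by rewrite cone_subdivision card_cone => /proper_card; rewrite sk.
rewrite (Some_subdivision cD sD) card_Some in_setD1 => /andP[_]; exact: card_le_dim.
Qed.

(** Induction on the subdivisions. The complex axioms and the dimension are carried along because
    the next subdivision needs them; orientations are quantified so that the intermediate complex
    can be given any. *)
Lemma card_flows_refinement (G : finZmodType) (T : finType) (D : {set {set T}})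
    (U : finType) (E : {set {set U}}) k :
  refinement D E -> simplicial_complex D -> complex_dim D = k.+1 ->
  [/\ simplicial_complex E, complex_dim E = k.+1 &
      forall oD oE, orients oD D -> orients oE E ->
        #|flows G E oE k| = #|flows G D oD k|].
Proof.
move=> ref cD dD; elim: ref => [|V F s _ [cF dF IH] sF].
  by split=> // oD oE oDD oEE; exact: card_flows_orientation.
have dE := complex_dim_subdivision cF dF sF.
move: sF; rewrite /facets dF inE => /andP[sF /eqP sk].
have Fmax t : t \in F -> (#|t| <= k.+2)%N by exact: card_le_dim.
have cE := subdivision_complex cF sF sk Fmax.
split=> // oD oE oDD oEE; rewrite -(IH oD _ oDD (@orients_enum _ F)).
rewrite -(card_flows_subdivision cF sF sk Fmax (@orients_enum _ F)).
apply: card_flows_orientation => //.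
exact: subdivision_orients.
Qed.

Theorem theorem3p7 (T U : finType) (D : {set {set T}}) (Y : {set {set U}})
    (d : nat) (oD : {set T} -> seq T) (oY : {set U} -> seq U) :
  simplicial_complex D -> simplicial_complex Y ->
  (1 <= d)%N -> complex_dim D = d -> complex_dim Y = d ->
  orients oD D -> orients oY Y ->
  combinatorially_equivalent D Y ->
  forall q : nat, (0 < q)%N ->
  nb_nowhere_zero_flows D oD q = nb_nowhere_zero_flows Y oY q.
Proof.
move=> cD cY; case: d => // k _ dD dY oDD oYY [T' [U' [D' [Y' [refD refY iso]]]]].
case=> // q _; rewrite !(@nb_nowhere_zero_flowsE _ _ _ _ k) //.
have [cD' _ flD] := card_flows_refinement 'I_q.+1 refD cD dD.
have [cY' _ flY] := card_flows_refinement 'I_q.+1 refY cY dY.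
have oD' := @orients_enum _ D'; have oY' := @orients_enum _ Y'.
(* Both counts are moved to the refinements, where the isomorphism compares them. *)
rewrite -(flD _ _ oDD oD') -(flY _ _ oYY oY').
by rewrite (card_flows_isomorphic _ _ cD' cY' oD' oY' iso).
Qed.
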